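(* There exists a connected cubic graph $G$ on fifty vertices such that $G$ has a unique minimum maximal matching, this matching admits no dominating transversal, and yet $\gamma(G) = 14 < 15 = \gamma_e(G)$.
   Context: Graphs are finite, simple and undirected; cubic means $3$-regular. The domination number $\gamma(G)$ is the minimum size of a set $S$ of vertices such that every vertex outside $S$ has a neighbour in $S$. A matching is a set of edges no two of which share a vertex; it is maximal if no edge of $G$ can be added to it. The edge domination number $\gamma_e(G)$ is the minimum size of a maximal matching of $G$, and a minimum maximal matching is a maximal matching of size $\gamma_e(G)$. For a matching $M$, $V(M)$ is the set of vertices lying on edges of $M$; the other vertices are unsaturated by $M$. A transversal of $M$ is a set $T \subseteq V(M)$ containing exactly one endpoint of each edge of $M$. A transversal $T$ is dominating if every vertex of $G$ unsaturated by $M$ has a neighbour in $T$. *)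

(* Defs.v *)
From mathcomp Require Import all_boot.

Set Implicit Arguments.
Unset Strict Implicit.
Unset Printing Implicit Defensive.

Record sgraph := SGraph {
  vertex :> finType;
  adj : rel vertex;
  adj_sym : symmetric adj;
  adj_irrefl : irreflexive adj
}.

Arguments adj {G} x y : rename.

Section Graphs.
Variable G : sgraph.
Implicit Types (S T E : {set G}) (M : {set {set G}}).

Definition neighbours (x : G) : {set G} := [set y | adj x y].

Definition cubic : Prop := forall x : G, #|neighbours x| = 3.

(* The empty graph satisfies this; it is only used on nonempty graphs. *)
Definition connected_graph : Prop := forall x y : G, connect adj x y.

Definition dominating S : bool :=
  [forall x, (x \notin S) ==> [exists y in S, adj x y]].

Definition domination_number : nat :=
  #|[arg min_(S < [set: G] | dominating S) #|S|]|.

Definition edges : {set {set G}} :=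
  [set E | [exists x, exists y, adj x y && (E == [set x; y])]].

Definition matching M : bool := (M \subset edges) && trivIset M.

Definition maximal_matching M : bool :=
  matching M && [forall E in edges, (E \notin M) ==> ~~ matching (E |: M)].

Lemma exists_maximal_matching : exists M, maximal_matching M.
Proof.
have m0 : matching set0.
  by rewrite /matching sub0set; apply/trivIsetP=> A B; rewrite inE.
have [M /maxsetP[mM maxM] _] := maxset_exists m0.
exists M; rewrite /maximal_matching mM; apply/forall_inP=> E _.
apply/implyP=> EM; apply/negP=> mE.
by move: EM; rewrite -(maxM _ mE (subsetUr _ _)) setU11.
Qed.

(* The base point of [arg min] only has to satisfy the predicate; the
   cardinality of the minimiser does not depend on it. *)
Definition edge_domination_number : nat :=
  #|[arg min_(M < xchoose exists_maximal_matching | maximal_matching M) #|M|]|.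

Definition minimum_maximal_matching M : bool :=
  maximal_matching M && (#|M| == edge_domination_number).

(* The set V(M) of saturated vertices is [cover M], the union of the edges. *)
Definition transversal_of M T : bool :=
  (T \subset cover M) && [forall E in M, #|T :&: E| == 1].

Definition dominating_transversal M T : bool :=
  transversal_of M T &&
  [forall x, (x \notin cover M) ==> [exists y in T, adj x y]].

End Graphs.

Arguments cubic : clear implicits.
Arguments connected_graph : clear implicits.
Arguments edges : clear implicits.
Arguments domination_number : clear implicits.
Arguments edge_domination_number : clear implicits.

(* Main.v *)
(** The vertices unsaturated by a maximal matching are independent, so in a
    cubic graph on 50 vertices a maximal matching has at least 15 edges, with
    equality only if every edge meets exactly one matching edge.  Given a
    3-CNF formula with 15 variables, 20 clauses and every literal occurring
    exactly twice, take the literals and the clauses as vertices, and join a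
    literal to its negation and to the clauses containing it: the edges
    {l, ~l} form such a matching M.  A dominating transversal of M is a
    satisfying assignment, so we start from an unsatisfiable formula,
    built from the enforcers of Berman, Karpinski and Scott.  That M is the only maximal matching of size
    at most 15, and that no 13 vertices dominate, is decided by an exhaustive
    search for small covers, pruned by counting. *)

Require Import Defs.
From mathcomp Require Import all_boot.

Set Implicit Arguments.
Unset Strict Implicit.
Unset Printing Implicit Defensive.

(** * Exhaustive search for small covers *)

Section Covers.
Variables (T : eqType) (r : nat) (nb : T -> seq T).

(** The list [nb w] holds the points that [w] covers. The search is meant for symmetric relations,
    so [nb u] also lists the candidates for covering [u]. *)
Fixpoint covers (k : nat) (U : seq T) : seq (seq T) :=
  if U isn't u :: _ then [:: [::]] else
  if k isn't k'.+1 then [::] else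
  if r * k < size U then [::] else
  flatten [seq map (cons w) (covers k' (filter (predC (mem (nb w))) U))
          | w <- nb u].

Lemma size_flatten_le (S : seq T) :
  {in S, forall w, size (nb w) <= r} ->
  size (flatten (map nb S)) <= r * size S.
Proof.
elim: S => [|w S IH] H //=.
rewrite size_cat mulnS leq_add ?H ?mem_head // IH // => v vS.
by apply: H; rewrite inE vS orbT.
Qed.

(** Some [w] in [S] covers the first point, and by symmetry its branch is explored; [S] without [w]
    still covers what [w] leaves. By counting, the pruning never cuts off [S]. Only a part [C] of
    [S] is found, since the search stops once every point is covered. *)
Lemma coversP (k : nat) (U S : seq T) :
    {in S, forall w, size (nb w) <= r} ->
    {in S & U, forall w u, u \in nb w -> w \in nb u} ->
    uniq U -> size S <= k ->
    {in U, forall u, exists2 w, w \in S & u \in nb w} ->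
  exists2 C, C \in covers k U & {subset C <= S}.
Proof.
elim: k U S => [|k IH] [|u U] S nb_r nb_sym U_uniq S_k cov;
  try by exists [::]; rewrite ?mem_head.
  have [w wS _] := cov u (mem_head _ _).
  by case: S wS S_k {nb_r nb_sym cov}.
have [w wS u_w] := cov u (mem_head _ _).
have small : size (u :: U) <= r * k.+1.
  apply: leq_trans (leq_trans (size_flatten_le nb_r) _); last first.
    by rewrite leq_mul2l S_k orbT.
  apply: uniq_leq_size U_uniq _ => v /cov[x xS v_x].
  by apply/flatten_mapP; exists x.
have subS : {subset rem w S <= S} by apply: mem_rem.
have [|||||C C_cov C_sub] :=
    IH (filter (predC (mem (nb w))) (u :: U)) (rem w S).
- by move=> x /subS; apply: nb_r.
- by move=> x v /subS xS; rewrite mem_filter => /andP[_ vU]; apply: nb_sym.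
- exact: filter_uniq.
- by rewrite size_rem // -ltnS prednK //; case: (S) wS.
- move=> v; rewrite mem_filter => /andP[/= v_w /cov[x xS v_x]].
  exists x => //; case: (eqVneq x w) v_w => [<- | x_w _]; first by rewrite v_x.
  by have:= xS; rewrite (perm_mem (perm_to_rem wS)) inE (negPf x_w).
exists (w :: C) => [|x]; last by rewrite inE => /predU1P[->|/C_sub/subS].
rewrite [covers _ _]/= ltnNge small /=.
apply/flatten_mapP; exists w; last exact: map_f.
by apply: nb_sym; rewrite ?mem_head.
Qed.

End Covers.

(** * An unsatisfiable formula and its cubic graph *)

(* The literals of the i-th variable are coded 2i and 2i+1. *)
Definition neg (l : nat) : nat := if odd l then l.-1 else l.+1.

(* Three clauses say [a -> b -> c -> a] if [l1], [l2], [l3] are all false; the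
   last two forbid [a = b = c]. *)
Definition enforcer (l1 l2 l3 a : nat) : seq (seq nat) :=
  let b := a.+2 in let c := a.+4 in
  [:: [:: l1; neg a; b]; [:: l2; neg b; c]; [:: l3; a; neg c];
      [:: a; b; c]; [:: neg a; neg b; neg c]].

(** With x, y, z coded by 0, 2, 4, the enforcers stand for the contradictory clauses x or y, not x
    or y, not y or z, not y or not z. Repeating a literal brings its occurrences to two, and an
    enforcer puts the copies in different clauses, so no double edge arises. *)
Definition clauses : seq (seq nat) :=
  enforcer 0 0 2 6 ++ enforcer 1 1 2 12 ++
  enforcer 3 4 4 18 ++ enforcer 3 5 5 24.

(* The j-th clause is the vertex 30 + j. *)
Definition nbr (v : nat) : seq nat :=
  if v < 30 then neg v :: [seq 30 + j | j <- iota 0 20 & v \in nth [::] clauses j]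
  else nth [::] clauses (v - 30).

Lemma all_iota n (P : pred nat) :
  all P (iota 0 n) -> forall v, v < n -> P v.
Proof. by move=> /allP H v v_n; apply: H; rewrite mem_iota. Qed.

Lemma nbr_sym_lt v w : v < 50 -> w < 50 -> (w \in nbr v) = (v \in nbr w).
Proof.
move=> v50 w50; apply/eqP.
have := @all_iota 50 (fun v => all (fun w => (w \in nbr v) == (v \in nbr w))
                                   (iota 0 50)).
by move=> H; apply: all_iota (H _ v v50) w w50; vm_compute.
Qed.

Lemma nbr_irrefl v : v < 50 -> v \notin nbr v.
Proof. by move: v; apply: (@all_iota _ (fun v => v \notin nbr v)); vm_compute. Qed.

Lemma nbr_lt v : v < 50 -> {in nbr v, forall w, w < 50}.
Proof.
move=> v50; apply/allP; move: v v50.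
by apply: (@all_iota _ (fun v => all (fun w => w < 50) (nbr v))); vm_compute.
Qed.

Lemma nbr_uniq v : v < 50 -> uniq (nbr v).
Proof. by move: v; apply: (@all_iota _ (fun v => uniq (nbr v))); vm_compute. Qed.

Lemma size_nbr v : v < 50 -> size (nbr v) = 3.
Proof.
move=> v50; apply/eqP; move: v v50.
by apply: (@all_iota _ (fun v => size (nbr v) == 3)); vm_compute.
Qed.

Definition formula_adj : rel 'I_50 := fun x y => val y \in nbr x.

Lemma formula_adj_sym : symmetric formula_adj.
Proof. by move=> x y; apply: nbr_sym_lt; apply: ltn_ord. Qed.

Lemma formula_adj_irrefl : irreflexive formula_adj.
Proof. by move=> x; apply/negbTE/nbr_irrefl/ltn_ord. Qed.

Definition formula_graph : sgraph := SGraph formula_adj_sym formula_adj_irrefl.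

Local Notation G := formula_graph.

(** Finite checks run on natural numbers, where [vm_compute] is effective; [vtx] transports them to
    the graph and is faithful only below 50. *)
Definition vtx (v : nat) : G := inord v : 'I_50.

Lemma vtxK v : v < 50 -> val (vtx v : 'I_50) = v.
Proof. exact: inordK. Qed.

Lemma val_vtx (x : G) : vtx (val (x : 'I_50)) = x.
Proof. exact: inord_val. Qed.

Lemma vtxP (x : G) : exists2 v, v < 50 & x = vtx v.
Proof. by exists (val (x : 'I_50)); rewrite ?val_vtx ?ltn_ord. Qed.

Lemma vtx_eq v w : v < 50 -> w < 50 -> (vtx v == vtx w) = (v == w).
Proof. by move=> v50 w50; rewrite -(inj_eq (@ord_inj 50)) !vtxK. Qed.

Lemma adj_vtx v w : v < 50 -> w < 50 -> adj (vtx v) (vtx w) = (w \in nbr v).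
Proof. by move=> v50 w50; rewrite /= /formula_adj !vtxK. Qed.

Lemma adj_nbrP v (y : G) :
  v < 50 -> reflect (exists2 w, w \in nbr v & y = vtx w) (adj (vtx v) y).
Proof.
move=> v50; have -> : adj (vtx v) y = (val (y : 'I_50) \in nbr v).
  by rewrite -{1}(val_vtx y) adj_vtx ?ltn_ord.
apply: (iffP idP) => [y_v | [w w_v ->]]; last by rewrite vtxK // (nbr_lt v50).
by exists (val (y : 'I_50)); rewrite ?val_vtx.
Qed.

Lemma formula_cubic : cubic G.
Proof.
move=> x; have [v v50 ->] := vtxP x.
rewrite -(size_nbr v50) -(size_map vtx).
have /card_uniqP <-: uniq (map vtx (nbr v)).
  rewrite map_inj_in_uniq ?nbr_uniq // => u w /(nbr_lt v50) u50 /(nbr_lt v50) w50.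
  by move/eqP; rewrite vtx_eq // => /eqP.
apply: eq_card => y; rewrite inE.
by apply/(adj_nbrP y v50)/mapP => -[w]; exists w.
Qed.

Definition grow (s : seq nat) : seq nat :=
  [seq v <- iota 0 50 | (v \in s) || has (mem s) (nbr v)].

Lemma formula_connected : connected_graph G.
Proof.
have grow0 n v : v \in iter n grow [:: 0] -> connect adj (vtx 0) (vtx v).
  elim: n v => [|n IH] v /=; first by rewrite inE => /eqP->.
  rewrite mem_filter mem_iota => /andP[/orP[/IH // | /hasP[w w_v /= /IH c_w]] v50].
  apply: connect_trans c_w (connect1 _).
  have w50 : w < 50 by apply: nbr_lt w_v.
  by rewrite adj_vtx // nbr_sym_lt.
have root x : connect adj (vtx 0) x.
  (* Twelve rounds of breadth-first search from vertex 0 reach every vertex. *)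
  have [v v50 ->] := vtxP x; apply: (grow0 12); move: v v50.
  by apply: (@all_iota _ (fun v => v \in iter 12 grow [:: 0])); vm_compute.
move=> x y; apply: connect_trans (root y).
by rewrite (sym_connect_sym (@adj_sym G)).
Qed.

(** * The domination number *)

(* Listing the vertices gadget by gadget keeps the searches small. *)
Definition order : seq nat :=
  iota 6 6 ++ iota 30 5 ++ iota 0 2 ++ iota 12 6 ++ iota 35 5 ++ iota 2 2 ++
  iota 18 6 ++ iota 40 5 ++ iota 4 2 ++ iota 24 6 ++ iota 45 5.

Lemma mem_order v : (v \in order) = (v < 50).
Proof.
have p : perm_eq order (iota 0 50) by vm_compute.
by rewrite (perm_mem p) mem_iota.
Qed.

(** Thirteen closed neighbourhoods have total size 52, so in covering 50 vertices they could waste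
    at most two places; this makes the pruning effective. *)
Lemma no_dominating_13 (S : {set G}) : dominating S -> 13 < #|S|.
Proof.
move=> /forallP domS; rewrite ltnNge; apply/negP => S13.
pose vals := [seq val (x : 'I_50) | x <- enum S].
have vals50 : {in vals, forall v, v < 50} by move=> _ /mapP[x _ ->]; apply: ltn_ord.
have [||||u|C] := @coversP _ 4 (fun v => v :: nbr v) 13 order vals.
- by move=> v /vals50 v50; rewrite /= size_nbr.
- move=> v u /vals50 v50; rewrite mem_order => u50.
  by rewrite !inE eq_sym nbr_sym_lt.
- by vm_compute.
- by rewrite size_map -cardE.
- rewrite mem_order => u50; have /implyP dom_u := domS (vtx u).
  case: (boolP (vtx u \in S)) => [uS | /dom_u/exists_inP[y yS]].
    exists u; last exact: mem_head.
    by rewrite -(vtxK u50) map_f // mem_enum.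
  have [w w50 y_w] := vtxP y; rewrite y_w adj_vtx // => w_u.
  exists w; last by rewrite inE nbr_sym_lt // w_u orbT.
  by rewrite -(vtxK w50) -y_w map_f // mem_enum.
suff -> : covers 4 (fun v => v :: nbr v) 13 order = [::] by [].
by vm_compute.
Qed.

Lemma formula_domination : domination_number G = 14.
Proof.
rewrite /domination_number; case: arg_minnP => [|S domS minS].
  by apply/forallP => x; rewrite inE.
apply/eqP; rewrite eqn_leq no_dominating_13 // andbT.
(* In the first and third gadgets, 0, 2, 3, 4 dominate the three cyclic clauses, so the other two
   clauses suffice for all six inner literals. Against one literal per variable this saves two
   vertices, and taking both 2 and 3 costs one: 15 - 2 + 1 = 14. *)
pose L := [:: 0; 2; 3; 4; 13; 14; 16; 24; 27; 28; 33; 34; 43; 44].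
apply: leq_trans (minS [set x in map vtx L] _) _; last first.
  by rewrite cardsE (leq_trans (card_size _)).
apply/forallP => x; have [v v50 ->] := vtxP x; apply/implyP.
have : (v \in L) || has (mem L) (nbr v).
  move: v v50 {x}.
  by apply: (@all_iota _ (fun v => (v \in L) || has (mem L) (nbr v))); vm_compute.
rewrite inE => /orP[vL | /hasP[w w_v wL]] vS; first by rewrite map_f in vS.
apply/exists_inP; exists (vtx w); first by rewrite inE map_f.
by rewrite adj_vtx // (nbr_lt v50).
Qed.

(** * Edges and maximal matchings *)

Definition edge_list : seq (nat * nat) :=
  flatten [seq [seq (v, w) | w <- nbr v & v < w] | v <- order].

Definition meet (p q : nat * nat) : bool :=
  [|| p.1 == q.1, p.1 == q.2, p.2 == q.1 | p.2 == q.2].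

Definition meeting (p : nat * nat) : seq (nat * nat) := filter (meet p) edge_list.

Definition edge (p : nat * nat) : {set G} := [set vtx p.1; vtx p.2].

Lemma meet_refl p : meet p p. Proof. by rewrite /meet eqxx. Qed.

Lemma meet_sym p q : meet p q = meet q p.
Proof.
rewrite /meet (eq_sym q.1 p.1) (eq_sym q.1 p.2) (eq_sym q.2 p.1) (eq_sym q.2 p.2).
by rewrite (orbCA (p.2 == q.1)).
Qed.

Lemma mem_edge_list p :
  p \in edge_list -> [/\ p.1 < 50, p.2 < 50, p.1 < p.2 & p.2 \in nbr p.1].
Proof.
move=> /flatten_mapP[v]; rewrite mem_order => v50 /mapP[w].
by rewrite mem_filter => /andP[v_w w_v] -> /=; rewrite (nbr_lt v50 w_v).
Qed.

Lemma edgesP E : reflect (exists2 p, p \in edge_list & E = edge p) (E \in edges G).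
Proof.
rewrite inE; apply: (iffP existsP) => [[x /existsP[y /andP[]]] | [p]].
  have [v v50 ->] := vtxP x; have [w w50 ->] := vtxP y.
  rewrite adj_vtx // => w_v /eqP->.
  case: (ltngtP v w) => [v_w | w_v' | v_w].
  - exists (v, w) => //; apply/flatten_mapP; exists v; first by rewrite mem_order.
    by rewrite map_f // mem_filter v_w.
  - exists (w, v); last by rewrite /edge setUC.
    apply/flatten_mapP; exists w; first by rewrite mem_order.
    by rewrite map_f // mem_filter w_v' nbr_sym_lt.
  by rewrite v_w in w_v; move: (nbr_irrefl w50); rewrite w_v.
move=> /mem_edge_list[p1 p2 _ adj_p] ->; exists (vtx p.1); apply/existsP.
by exists (vtx p.2); rewrite eqxx adj_vtx // adj_p.
Qed.

Lemma edge_list_uniq : uniq edge_list.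
Proof. by vm_compute. Qed.

Lemma edge_disjoint : {in edge_list &, forall p q,
  [disjoint edge p & edge q] = ~~ meet p q}.
Proof.
move=> p q /mem_edge_list[p1 p2 _ _] /mem_edge_list[q1 q2 _ _].
by rewrite -setI_eq0 setIUl setU_eq0 !setI_eq0 !disjoints1 !inE !vtx_eq // -negb_or -orbA.
Qed.

Lemma edge_inj : {in edge_list &, injective edge}.
Proof.
move=> p q /mem_edge_list[p1 p2 p_lt _] /mem_edge_list[q1 q2 q_lt _] pq.
have [x y] : vtx p.1 \in edge q /\ vtx p.2 \in edge q.
  by rewrite -pq !inE !eqxx orbT.
move: x y; rewrite !inE !vtx_eq //.
case: p q p_lt q_lt {p1 p2 q1 q2 pq} => [a b] [c d] /= a_b c_d.
case/orP=> /eqP ea; case/orP=> /eqP eb; subst; rewrite ?ltnn // in a_b.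
by rewrite ltnNge (ltnW c_d) in a_b.
Qed.

Lemma size_meeting p : p \in edge_list -> size (meeting p) <= 5.
Proof.
suff /allP H : all (fun p => size (meeting p) <= 5) edge_list by apply: H.
by vm_compute.
Qed.

Definition literal_pairs : seq (nat * nat) := [seq (i.*2, i.*2.+1) | i <- iota 0 15].

Definition literal_matching : {set {set G}} :=
  [set E in map edge literal_pairs].

Lemma literal_pairs_edge : {subset literal_pairs <= edge_list}.
Proof. by apply/allP; vm_compute. Qed.

Lemma mem_literal_matching E :
  reflect (exists2 p, p \in literal_pairs & E = edge p) (E \in literal_matching).
Proof. by rewrite inE; apply: mapP. Qed.

Lemma card_literal_matching : #|literal_matching| = 15.
Proof.
rewrite cardsE; have /card_uniqP -> : uniq (map edge literal_pairs).
  rewrite map_inj_in_uniq; first by vm_compute.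
  by move=> p q /literal_pairs_edge pE /literal_pairs_edge qE; apply: edge_inj.
by rewrite size_map.
Qed.

Lemma literal_matching_maximal : maximal_matching literal_matching.
Proof.
apply/andP; split; first (apply/andP; split).
- apply/subsetP => _ /mem_literal_matching[p /literal_pairs_edge pE ->].
  by apply/edgesP; exists p.
- apply/trivIsetP => _ _ /mem_literal_matching[p pL ->] /mem_literal_matching[q qL ->].
  rewrite edge_disjoint ?literal_pairs_edge //; apply: contraNN => pq.
  suff /allP/(_ p pL)/allP/(_ q qL)/implyP/(_ pq)/eqP-> :
    all (fun p => all (fun q => meet p q ==> (p == q)) literal_pairs) literal_pairs.
    by [].
  by vm_compute.
apply/forall_inP => _ /edgesP[p pE ->]; apply/implyP => pM.
(* Clauses are pairwise non-adjacent, so every edge has a literal as an end. *)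
have /allP/(_ p pE)/hasP[q qL pq] :
  all (fun p => has (meet p) literal_pairs) edge_list by vm_compute.
have qM : edge q \in literal_matching by apply/mem_literal_matching; exists q.
have qE := literal_pairs_edge qL.
have pq_neq : edge p != edge q by apply: contraNneq pM => ->.
apply/negP => /andP[_ /trivIsetP/(_ (edge p) (edge q))].
by rewrite edge_disjoint // pq setU11 setU1r // => /(_ isT isT pq_neq).
Qed.

(** Each edge meets five edges, itself included, and there are 75 edges, so 15 edges meeting all of
    them leave no slack. Every cover found by the search contains all literal pairs; hence so does
    [M], and cardinality forces equality. *)
Lemma maximal_matching_15 (M : {set {set G}}) :
  maximal_matching M -> #|M| <= 15 -> M = literal_matching.
Proof.
move=> /andP[/andP[/subsetP M_edges M_triv] /forall_inP M_max] M15.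
apply/esym/eqP; rewrite eqEcard card_literal_matching M15 andbT.
pose S := [seq p <- edge_list | edge p \in M].
have S_edge : {subset S <= edge_list} by apply: mem_subseq; apply: filter_subseq.
have [||||p pE|C C_cov C_S] := @coversP _ 5 meeting 15 edge_list S.
- by move=> p /S_edge; apply: size_meeting.
- by move=> p q /S_edge pE _; rewrite !mem_filter meet_sym pE => /andP[->].
- exact: edge_list_uniq.
- apply: leq_trans M15; rewrite -(size_map edge) cardE; apply: uniq_leq_size.
    rewrite map_inj_in_uniq => [|p q /S_edge pE /S_edge qE]; last exact: edge_inj.
    exact: filter_uniq edge_list_uniq.
  by move=> _ /mapP[p + ->]; rewrite mem_filter mem_enum => /andP[].
- have [pM | pM] := boolP (edge p \in M).
    by exists p; rewrite mem_filter ?meet_refl ?pM.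
  have pG : edge p \in edges G by apply/edgesP; exists p.
  have [[q qS pq] | no_meet] := hasP (a := meet p) (s := S).
    by exists q; rewrite // mem_filter meet_sym pq.
  (* An edge that meets no edge of [M] could be added to [M]. *)
  case/negP: (implyP (M_max _ pG) pM); apply/andP; split.
    by apply/subsetP => E /setU1P[->|/M_edges].
  have no_meetM E : E \in M -> [disjoint edge p & E].
    move=> EM; have /edgesP[q qE E_q] := M_edges _ EM.
    rewrite E_q edge_disjoint //; apply/negP => pq; case: no_meet.
    by exists q; rewrite // mem_filter -E_q EM.
  apply/trivIsetP => A B /setU1P[->|AM] /setU1P[->|BM]; rewrite ?eqxx //.
  - by move=> _; apply: no_meetM.
  - by move=> _; rewrite disjoint_sym; apply: no_meetM.
  exact: (trivIsetP M_triv).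
have /allP/(_ C C_cov)/allP LC :
  all (fun C => all (mem C) literal_pairs) (covers 5 meeting 15 edge_list).
  by vm_compute.
apply/subsetP => _ /mem_literal_matching[p /LC/C_S + ->].
by rewrite mem_filter => /andP[].
Qed.

Lemma formula_edge_domination : edge_domination_number G = 15.
Proof.
rewrite /edge_domination_number; case: arg_minnP => [|M maxM minM].
  exact: xchooseP.
have M15 := minM _ literal_matching_maximal.
rewrite card_literal_matching in M15.
by rewrite (maximal_matching_15 maxM M15) card_literal_matching.
Qed.

(** * Unsatisfiability and transversals *)

Lemma enforcerP (t : pred nat) l1 l2 l3 a :
    {in [:: a; a.+2; a.+4], forall l, t (neg l) = ~~ t l} ->
    all (has t) (enforcer l1 l2 l3 a) ->
  [|| t l1, t l2 | t l3].
Proof.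
move=> tN; rewrite /enforcer /= !tN ?inE ?eqxx ?orbT //.
by case: (t l1) (t l2) (t l3) (t a) (t a.+2) (t a.+4) => [] [] [] [] [] [].
Qed.

Lemma clauses_unsat (t : pred nat) :
  (forall l, l < 30 -> t (neg l) = ~~ t l) -> ~~ all (has t) clauses.
Proof.
move=> tN; apply/negP; rewrite /clauses !all_cat.
have enf l1 l2 l3 a : a < 26 -> all (has t) (enforcer l1 l2 l3 a) ->
    [|| t l1, t l2 | t l3].
  move=> a26; apply: enforcerP => l l_a; apply: tN.
  apply: (@leq_ltn_trans a.+4); last by rewrite !ltnS.
  by move: l_a; rewrite !inE => /or3P[] /eqP->; rewrite // ?(leq_addl 2) ?(leq_addl 4).
case/and4P => /enf-/(_ isT) + /enf-/(_ isT) + /enf-/(_ isT) + /enf-/(_ isT).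
(* The first two enforcers force literal 2, by cases on 0; the last two force its negation 3, by
   cases on 4. *)
rewrite (tN 0) // (tN 2) // (tN 4) //.
by case: (t 0) (t 2) (t 4) => [] [] [].
Qed.

Lemma cover_literal_matching v :
  v < 50 -> (vtx v \in cover literal_matching) = (v < 30).
Proof.
move=> v50; apply/bigcupP/idP.
  case=> _ /mem_literal_matching[p /mapP[i i15 ->] ->].
  rewrite mem_iota /= in i15.
  have i30 : i.*2.+1 < 30 by rewrite -doubleS (leq_double i.+1 15).
  have i50 : i.*2.+1 < 50 by apply: leq_trans i30 _.
  rewrite /edge !in_set2 !vtx_eq // ?(ltnW i50) //.
  by case/orP=> /eqP->; rewrite ?(ltnW i30).
move=> v30; exists (edge (v./2.*2, v./2.*2.+1)).
  apply/mem_literal_matching; exists (v./2.*2, v./2.*2.+1) => //.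
  by rewrite (map_f (fun i => (i.*2, i.*2.+1))) // mem_iota /= ltn_half_double.
have := odd_double_half v; rewrite /edge in_set2.
by case: (odd v); rewrite ?add1n ?add0n => ->; rewrite eqxx ?orbT.
Qed.

Lemma literal_matching_no_dominating_transversal (T : {set G}) :
  ~~ dominating_transversal literal_matching T.
Proof.
apply/negP => /andP[/andP[/subsetP T_sub /forall_inP T_one] /forallP T_dom].
pose t v := vtx v \in T.
have pair_one i : i < 15 -> t i.*2.+1 = ~~ t i.*2.
  move=> i15; have i30 : i.*2.+1 < 30 by rewrite -doubleS (leq_double i.+1 15).
  have i50 : i.*2.+1 < 50 by apply: leq_trans i30 _.
  have /T_one/cards1P[x T_x] : edge (i.*2, i.*2.+1) \in literal_matching.
    apply/mem_literal_matching; exists (i.*2, i.*2.+1) => //.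
    by rewrite (map_f (fun i => (i.*2, i.*2.+1))) // mem_iota.
  have ne : vtx i.*2 != vtx i.*2.+1 by rewrite vtx_eq ?(ltnW i50) // neq_ltn leqnn.
  move/setP: T_x => T_x; have := T_x (vtx i.*2); have := T_x (vtx i.*2.+1).
  have := T_x x; rewrite !inE !eqxx orbT !andbT => /andP[xT x_i].
  rewrite /t => -> ->; case/orP: x_i => /eqP->; last by rewrite eqxx ne.
  by rewrite eqxx eq_sym (negPf ne).
have tN l : l < 30 -> t (neg l) = ~~ t l.
  move=> l30; have i15 : l./2 < 15 by rewrite ltn_half_double.
  have := pair_one _ i15; rewrite /neg; have := odd_double_half l.
  case: (odd l); rewrite ?add1n ?add0n; move: (l./2.*2) => h <- //= ->.
  by rewrite negbK.
(* Clause vertices are unsaturated, and a neighbour in [T] is a true literal of the clause. *)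
case/negP: (clauses_unsat tN); apply/(all_nthP [::]) => j j20.
have j50 : 30 + j < 50 by rewrite (ltn_add2l 30 j 20).
have := T_dom (vtx (30 + j)); rewrite cover_literal_matching // -leqNgt leq_addr.
case/exists_inP => y yT /(adj_nbrP _ j50)[w].
rewrite /nbr ltnNge leq_addr /= addKn => w_j y_w.
by apply/hasP; exists w; rewrite // /t -y_w.
Qed.

Theorem theorem2 :
  exists G : sgraph,
    connected_graph G /\ cubic G /\ #|G| = 50 /\
    (exists M : {set {set G}},
        unique (fun N : {set {set G}} => minimum_maximal_matching N) M /\
        ~ (exists T : {set G}, dominating_transversal M T)) /\
    domination_number G = 14 /\ 14 < 15 /\ 15 = edge_domination_number G.
Proof.
exists formula_graph; split; first exact: formula_connected.
split; first exact: formula_cubic.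
split; first exact: card_ord.
split; last by rewrite formula_domination formula_edge_domination.
exists literal_matching; split; last first.
  by case=> T; apply/negP/literal_matching_no_dominating_transversal.
rewrite /minimum_maximal_matching formula_edge_domination; split.
  by rewrite literal_matching_maximal card_literal_matching.
by move=> M /andP[maxM /eqP M15]; rewrite (maximal_matching_15 maxM) ?M15.
Qed.
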